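(* $\mathbf{C_{=}P}\subseteq\mathbf{MNS}$.
   Context: For a polynomial $p$, a polynomial-time computable predicate $R$ and input $x$, write $N(x)=|\{y : |y|=p(|x|)\wedge R(x,y)\}|$. A language $L$ is in $\mathbf{C_{=}P}$ if there exist $p,R$ such that for all $x$: $x\in L\iff N(x)=2^{p(|x|)-1}$. A language $L$ is in $\mathbf{MNS}$ if there exist $p,R$ such that for all $x$: $x\in L\iff N(x)=2^t-1$ for some $t\in\{1,2,3,\dots\}$. *)

(* Defs.v *)
From HB Require Import structures.
From mathcomp Require Import all_boot all_order all_algebra.

Set Implicit Arguments.
Unset Strict Implicit.
Unset Printing Implicit Defensive.

Import GRing.Theory Num.Theory.

Definition word := seq bool.
Definition language := word -> Prop.

Inductive move := MoveL | Stay | MoveR.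

Definition displacement (d : move) : int :=
  match d with MoveL => (-1)%R | Stay => 0%R | MoveR => 1%R end.

(* Deterministic Turing machines with tm_work + 2 two-way infinite tapes,
   computing predicates of two words: the first argument is initially on
   tape 0, the second on tape 1, and the other tapes are blank. *)
Record machine := Machine {
  tm_work : nat;
  tm_state : finType;
  tm_sym : finType;
  tm_blank : tm_sym;
  tm_bit : bool -> tm_sym;
  tm_bit_inj : injective tm_bit;
  tm_bit_blank : forall b, tm_bit b != tm_blank;
  tm_start : tm_state;
  (* None: still running; Some b: halted with answer b *)
  tm_answer : tm_state -> option bool;
  tm_trans : tm_state -> {ffun 'I_tm_work.+2 -> tm_sym} ->
    tm_state * {ffun 'I_tm_work.+2 -> tm_sym * move}
}.

Record config (M : machine) := Config {
  cf_state : tm_state M;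
  cf_tape : 'I_(tm_work M).+2 -> int -> tm_sym M;
  cf_head : 'I_(tm_work M).+2 -> int
}.

Definition word_tape (M : machine) (w : word) (i : int) : tm_sym M :=
  match i with
  | Posz k => nth (tm_blank M) (map (@tm_bit M) w) k
  | Negz _ => tm_blank M
  end.

Definition init (M : machine) (x y : word) : config M :=
  Config (tm_start M)
    (fun k => match val k with
              | 0 => word_tape M x
              | 1 => word_tape M y
              | _ => word_tape M [::]
              end)
    (fun=> 0%R).

Definition step (M : machine) (c : config M) : config M :=
  if tm_answer (cf_state c) is Some _ then c else
  let: (q, act) :=
    tm_trans (cf_state c) [ffun k => cf_tape c k (cf_head c k)] in
  Config q
    (fun k i => if i == cf_head c k then (act k).1 else cf_tape c k i)
    (fun k => (cf_head c k + displacement (act k).2)%R).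

(* Halted configurations are fixed by [step], so this says that M halts
   within t steps with answer b. *)
Definition answers_within (M : machine) (t : nat) (x y : word) (b : bool) :=
  tm_answer (cf_state (iter t (@step M) (init M x y))) = Some b.

Definition polytime (R : word -> word -> bool) : Prop :=
  exists (M : machine) (q : {poly nat}), forall x y : word,
    answers_within M (q.[(size x + size y)%N])%R x y (R x y).

Definition nwit (p : {poly nat}) (R : word -> word -> bool) (x : word) : nat :=
  #|[set y : (p.[size x])%R.-tuple bool | R x y]|.

(* The equation is stated in rat because the exponent p(|x|) - 1 is -1 when
   p(|x|) = 0. *)
Definition CeqP (L : language) : Prop :=
  exists (p : {poly nat}) (R : word -> word -> bool),
    polytime R /\
    forall x, L x <->
      ((nwit p R x)%:R = 2%:R ^ ((p.[size x])%:Z - 1) :> rat)%R.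

Definition MNS (L : language) : Prop :=
  exists (p : {poly nat}) (R : word -> word -> bool),
    polytime R /\
    forall x, L x <-> exists t : nat, 1 <= t /\ nwit p R x = 2 ^ t - 1.

(* Main.v *)
(** Write [n = 2 ^ p(|x|)].  Prefixing every witness with two bits, one adds
    [3n/2 - 1] trivially accepted witnesses to the [N] given ones.  Since
    [N <= n], the successor of the new count lies in [[3n/2, 5n/2]], where the
    only power of two is [2n], attained exactly when [N = n/2].  A machine for
    the new predicate consumes the two bits from the second tape and then either
    decides on its own or runs the old machine on the remaining, translated,
    tape. *)

From HB Require Import structures.
From mathcomp Require Import all_boot all_order all_algebra.
From mathcomp Require Import zify.
Require Import Defs.

Set Implicit Arguments.
Unset Strict Implicit.
Unset Printing Implicit Defensive.

Import GRing.Theory Num.Theory.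

(** * Counting words *)

Definition word_count (n : nat) (P : pred word) : nat :=
  #|[set y : n.-tuple bool | P y]|.

Lemma word_count0 (P : pred word) : word_count 0 P = P [::].
Proof.
rewrite /word_count -sum1_card (eq_bigl (fun y : 0.-tuple bool => P y)); last first.
  by move=> y; rewrite inE.
rewrite big_mkcond (big_pred1 [tuple]) /=; first by case: (P [::]).
by move=> y; rewrite [y]tuple0 /= eqxx.
Qed.

Lemma word_countS (n : nat) (P : pred word) :
  word_count n.+1 P =
  word_count n (fun y => P (true :: y)) + word_count n (fun y => P (false :: y)).
Proof.
rewrite /word_count -!sum1dep_card big_mkcond /=.
rewrite (reindex (fun u : bool * n.-tuple bool => [tuple of u.1 :: u.2])) /=; last first.
  exists (fun y : n.+1.-tuple bool => (thead y, [tuple of behead y])) => [[b y] _|y _].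
    by congr pair; apply: val_inj.
  by case/tupleP: y => b y; apply: val_inj.
rewrite -(pair_bigA _ (fun b (y : n.-tuple bool) => if P (b :: y) then 1 else 0)) /=.
by rewrite big_bool -!big_mkcond.
Qed.

Lemma word_count_false (n : nat) : word_count n (fun=> false) = 0.
Proof. by elim: n => [|n IHn]; rewrite ?word_count0 // word_countS IHn. Qed.

Lemma word_count_true (n : nat) : word_count n (fun=> true) = 2 ^ n.
Proof.
by elim: n => [|n IHn]; rewrite ?word_count0 // word_countS IHn expnS mul2n addnn.
Qed.

(** Only the all-false word fails, which supplies the [- 1] of the target form [2 ^ t - 1]. *)
Lemma word_count_has (n : nat) : word_count n (has id) = 2 ^ n - 1.
Proof.
elim: n => [|n IHn]; rewrite ?word_count0 // word_countS /= word_count_true IHn.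
by rewrite expnS; have := expn_gt0 2 n; lia.
Qed.

Lemma word_count_le (n : nat) (P : pred word) : word_count n P <= 2 ^ n.
Proof. by rewrite (leq_trans (max_card _)) // card_tuple card_bool. Qed.

(* Rejecting the words of length 2 makes the count 0 when p(|x|) = 0: there
   C_=P asks for N = 1/2, which never holds, and 0 is not 2 ^ t - 1 for
   t >= 1. *)
Definition padded (R : word -> word -> bool) (x y : word) : bool :=
  if y is b1 :: b2 :: c :: z then
    match b1, b2 with
    | false, false => R x (c :: z)
    | false, true => true
    | true, false => ~~ c && has id z
    | true, true => false
    end
  else false.

Lemma word_count_padded0 R x : word_count 2 (padded R x) = 0.
Proof. by rewrite !word_countS !word_count0. Qed.

(** The two leading bits split the count into the original one, [2 ^ n.+1], [2 ^ n - 1] and [0].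
    Here [n] is one less than the original witness length. *)
Lemma word_count_padded R x n :
  word_count n.+3 (padded R x) =
  word_count n.+1 (R x) + 3 * 2 ^ n - 1.
Proof.
rewrite (word_countS n.+2) !(word_countS n.+1) !(word_countS n) /=.
rewrite !word_count_false !word_count_true word_count_has.
by have := expn_gt0 2 n; lia.
Qed.

(** The bounds [3 * 2 ^ n] and [5 * 2 ^ n] put [2 ^ t] strictly between [2 ^ n.+1] and [2 ^ n.+3],
    which forces [t = n.+2]. *)
Lemma pow2_in_window (N n t : nat) :
  N <= 2 ^ n.+1 -> 2 ^ t = N + 3 * 2 ^ n -> N = 2 ^ n.
Proof.
move=> N_le def_t; have n_gt0 : 0 < 2 ^ n by rewrite expn_gt0.
have lt_nt : n.+1 < t.
  by rewrite -(ltn_exp2l _ _ (isT : 1 < 2)) def_t expnS; lia.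
have lt_tn : t < n.+3.
  by rewrite -(ltn_exp2l _ _ (isT : 1 < 2)) def_t !expnS; rewrite expnS in N_le; lia.
have def_t' : t = n.+2 by lia.
by move: def_t; rewrite def_t' !expnS; lia.
Qed.

(** * A machine for padded witnesses *)

(** [Snd] and [Third] carry the bits read so far; [Scan] evaluates [has id] on the rest of the
    witness. *)
Inductive control :=
  | Fst | Snd of bool | Third of bool & bool | Scan | Halt of bool.

Definition control_code (q : control) : unit + bool + (bool * bool) + unit + bool :=
  match q with
  | Fst => inl (inl (inl (inl tt)))
  | Snd b => inl (inl (inl (inr b)))
  | Third b1 b2 => inl (inl (inr (b1, b2)))
  | Scan => inl (inr tt)
  | Halt b => inr b
  end.

Definition control_decode (u : unit + bool + (bool * bool) + unit + bool) : control :=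
  match u with
  | inl (inl (inl (inl _))) => Fst
  | inl (inl (inl (inr b))) => Snd b
  | inl (inl (inr (b1, b2))) => Third b1 b2
  | inl (inr _) => Scan
  | inr b => Halt b
  end.

Lemma control_codeK : cancel control_code control_decode.
Proof. by case. Qed.

HB.instance Definition _ := Finite.copy control (can_type control_codeK).

Section PaddedMachine.

Variable M : machine.

Definition tape1 : 'I_(tm_work M).+2 := Ordinal (isT : 1 < (tm_work M).+2).

Definition read_bit (s : tm_sym M) : option bool :=
  if s == tm_bit M true then Some true
  else if s == tm_bit M false then Some false else None.

Lemma read_bitK b : read_bit (tm_bit M b) = Some b.
Proof.
rewrite /read_bit; case: b; rewrite ?eqxx //.
by case: eqP => // /tm_bit_inj.
Qed.

Lemma read_bit_blank : read_bit (tm_blank M) = None.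
Proof.
by rewrite /read_bit ![tm_blank M == _]eq_sym !(negbTE (tm_bit_blank M _)).
Qed.

(* The boolean tells whether the scanned cell of tape 1 is erased and left. *)
Definition control_trans (q : control) (o : option bool) :
    (tm_state M + control) * bool :=
  match q, o with
  | Fst, Some b => (inr (Snd b), true)
  | Snd b1, Some b => (inr (Third b1 b), true)
  | Third false false, Some _ => (inl (tm_start M), false)
  | Third false true, Some _ => (inr (Halt true), false)
  | Third true false, Some false => (inr Scan, true)
  | Scan, Some true => (inr (Halt true), false)
  | Scan, Some false => (inr Scan, true)
  | _, _ => (inr (Halt false), false)
  end.

Definition padded_answer (q : tm_state M + control) : option bool :=
  match q with
  | inl q => tm_answer q
  | inr (Halt b) => Some b
  | inr _ => None
  end.

Definition padded_trans (q : tm_state M + control)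
    (s : {ffun 'I_(tm_work M).+2 -> tm_sym M}) :
    (tm_state M + control) * {ffun 'I_(tm_work M).+2 -> tm_sym M * move} :=
  match q with
  | inl q => let: (q', act) := tm_trans q s in (inl q', act)
  | inr q =>
      let: (q', eat) := control_trans q (read_bit (s tape1)) in
      (q', [ffun k => if eat && (k == tape1) then (tm_blank M, MoveR) else (s k, Stay)])
  end.

Definition padded_machine : machine :=
  @Machine (tm_work M) (tm_state M + control)%type (tm_sym M) (tm_blank M)
    (@tm_bit M) (@tm_bit_inj M) (@tm_bit_blank M) (inr Fst)
    padded_answer padded_trans.

Notation P := padded_machine.

(** * Simulation up to a translation of tape 1 *)

Definition shift (j : int) (k : 'I_(tm_work M).+2) : int :=
  if k == tape1 then j else 0%R.

(** States are left out so that the relation makes sense while the control runs. Tapes are compared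
    pointwise, which avoids functional extensionality. *)
Definition shifted (j : int) (c' : config P) (c : config M) : Prop :=
  forall k, cf_head c' k = (cf_head c k + shift j k)%R /\
  forall i, cf_tape c' k (i + shift j k)%R = cf_tape c k i.

Lemma shifted_init x y : shifted 0 (init P x y) (init M x y).
Proof.
move=> k; rewrite /shift if_same; split=> // i.
by rewrite addr0 /=; case: (val k) => [|[|?]].
Qed.

Lemma shifted_read j c' c k :
  shifted j c' c -> cf_tape c' k (cf_head c' k) = cf_tape c k (cf_head c k).
Proof. by move=> /(_ k) [-> ->]. Qed.

(** A transition sees only the scanned symbols and moves heads relatively, so it commutes with
    translations. *)
Lemma simulation_step j c' c :
  shifted j c' c -> cf_state c' = inl (cf_state c) ->
  shifted j (step c') (step c) /\ cf_state (step c') = inl (cf_state (step c)).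
Proof.
move=> sh st; rewrite /step st /=.
case: (tm_answer (cf_state c)) => [b|]; first by split.
have -> : [ffun k => cf_tape c' k (cf_head c' k)]
          = [ffun k => cf_tape c k (cf_head c k)] :> {ffun _ -> tm_sym M}.
  by apply/ffunP => k; rewrite !ffunE (shifted_read _ sh).
case: (tm_trans _ _) => q act /=; split=> // k /=.
have [-> tapes] := sh k; split=> [|i]; first by rewrite addrAC.
by rewrite tapes (inj_eq (addIr _)).
Qed.

Lemma simulation j c' c t :
  shifted j c' c -> cf_state c' = inl (cf_state c) ->
  cf_state (iter t (@step P) c') = inl (cf_state (iter t (@step M) c)).
Proof.
elim: t c' c => [|t IHt] c' c // sh st.
by have [sh1 st1] := simulation_step sh st; rewrite !iterSr (IHt _ _ sh1 st1).
Qed.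

(** Consumed bits are erased, so apart from its state the configuration is a fresh start of [M] on
    the remaining word [y], with tape 1 moved by [j]. *)
Definition at_word (j : int) (q : tm_state M + control) (x y : word) (c' : config P) :=
  cf_state c' = q /\ shifted j c' (init M x y).

Lemma read_head j q x y c' : at_word j q x y c' ->
  read_bit (cf_tape c' tape1 (cf_head c' tape1)) = ohead y.
Proof.
move=> [_ /shifted_read ->] /=.
by case: y => [|b y]; rewrite /= ?read_bit_blank ?read_bitK.
Qed.

Lemma stay_step j q x y c' q' :
  at_word j (inr q) x y c' -> padded_answer (inr q) = None ->
  control_trans q (ohead y) = (q', false) -> at_word j q' x y (step c').
Proof.
move=> at_c run tr; have rd := read_head at_c; have [st sh] := at_c.
have run' : tm_answer (cf_state c') = None by rewrite st.
rewrite /step run' st /= ffunE rd tr /=; split=> // k /=.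
have [hd tapes] := sh k; rewrite !ffunE /= hd addr0; split=> // i.
by case: eqP => [<-|_]; apply: tapes.
Qed.

Lemma word_tape_cons b y i :
  (if i == (-1)%R then tm_blank M else word_tape M (b :: y) (i + 1)%R)
  = word_tape M y i.
Proof.
by case: i => [n|[|n]] //; rewrite -PoszD addn1.
Qed.

Lemma eat_step j q x b y c' q' :
  at_word j (inr q) x (b :: y) c' -> padded_answer (inr q) = None ->
  control_trans q (Some b) = (q', true) -> at_word (j + 1)%R q' x y (step c').
Proof.
move=> at_c run tr; have rd := read_head at_c; have [st sh] := at_c.
have run' : tm_answer (cf_state c') = None by rewrite st.
rewrite /step run' st /= ffunE rd tr /=; split=> // k /=.
have [hd tapes] := sh k; rewrite !ffunE /=; move: hd tapes; rewrite /shift.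
case: eqP => [->|nk] /= hd tapes; last first.
  (* Only tape 1 of [init] depends on the second word, so the other tapes do not distinguish
     [b :: y] from [y]. *)
  have tapes' i : cf_tape c' k i = cf_tape (init M x y) k i.
    rewrite -[i in LHS]addr0 tapes /=; case def_k: (val k) => [|[|?]] //.
    by case: nk; apply: val_inj.
  rewrite hd !addr0; split=> // i.
  by case: eqP => [<-|_]; rewrite [(i + 0)%R]addr0; apply: tapes'.
rewrite hd !add0r; split=> // i.
(* The erased cell [j] is cell [-1] relative to the new origin [j + 1]. *)
rewrite -(word_tape_cons b) (_ : i + (j + 1) = i + 1 + j)%R; last by rewrite addrAC addrA.
by rewrite tapes -subr_eq0 addrK addr_eq0.
Qed.

(** Halted configurations are fixed points, so it suffices to find the answer at some earlier
    time. *)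
Lemma answer_stable (N : machine) (c : config N) s t b :
  s <= t -> tm_answer (cf_state (iter s (@step N) c)) = Some b ->
  tm_answer (cf_state (iter t (@step N) c)) = Some b.
Proof.
move=> /subnK <-; rewrite iterD; move: (iter s _ c) => d ans.
suff -> : iter (t - s) (@step N) d = d by [].
by elim: (t - s) => //= n ->; rewrite /step ans.
Qed.

(** At most one step per bit, and one more on the blank that ends the word. *)
Lemma scan_answer j x y c' :
  at_word j (inr Scan) x y c' ->
  tm_answer (cf_state (iter (size y).+1 (@step P) c')) = Some (has id y).
Proof.
elim: y j c' => [|[] y IHy] j c' at_c.
- by have [/= -> _] := stay_step at_c erefl erefl.
- apply: (@answer_stable _ _ 1) => //.
  by have [/= -> _] := stay_step at_c erefl erefl.
- by rewrite iterSr (IHy _ _ (eat_step at_c erefl erefl)).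
Qed.

End PaddedMachine.

(** * The polynomial time bound *)

Lemma horner_nat_le (q : {poly nat}) (m n : nat) : m <= n -> q.[m]%R <= q.[n]%R.
Proof.
move=> le_mn; rewrite !horner_coef; apply: leq_sum => i _.
rewrite leq_mul2l; case: (val i) => [|e]; rewrite ?orbT //.
by rewrite leq_exp2r // le_mn orbT.
Qed.

Lemma polytime_padded (R : word -> word -> bool) : polytime R -> polytime (padded R).
Proof.
(* [q] pays for the run of [M], ['X] for the scan, and the constant for the leading bits. *)
move=> [M [q MR]]; exists (padded_machine M), (q + 'X + 4%N%:P)%R => x y.
rewrite /answers_within 2!hornerD hornerX hornerC.
set t := (X in iter X).
have t_ge : q.[size x + size y]%R + (size x + size y) + 4 <= t by [].
have at0 : at_word 0%R (inr Fst) x y (init (padded_machine M) x y).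
  by split=> //; apply: shifted_init.
case: y t t_ge at0 => [|b1 y] t t_ge at0.
  apply: (@answer_stable _ _ 1); first by lia.
  by have [/= -> _] := stay_step at0 erefl erefl.
have at1 := eat_step at0 erefl erefl.
case: y t t_ge {at0} at1 => [|b2 y] t t_ge at1.
  apply: (@answer_stable _ _ 2); first by lia.
  by have [/= -> _] := stay_step at1 erefl erefl.
have at2 := eat_step at1 erefl erefl.
case: y t t_ge {at1} at2 => [|c z] t t_ge at2.
  apply: (@answer_stable _ _ 3); first by lia.
  by case: b1 b2 t_ge at2 => [] [] t_ge at2; have [/= -> _] := stay_step at2 erefl erefl.
case: b1 b2 t_ge at2 => [] [] t_ge at2.
- apply: (@answer_stable _ _ 3); first by lia.
  by have [/= -> _] := stay_step at2 erefl erefl.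
- case: c t_ge at2 => t_ge at2.
    apply: (@answer_stable _ _ 3); first by lia.
    by have [/= -> _] := stay_step at2 erefl erefl.
  apply: (@answer_stable _ _ ((size z).+1 + 3)); first by move: t_ge => /=; lia.
  by rewrite iterD; apply: scan_answer (eat_step at2 erefl erefl).
- apply: (@answer_stable _ _ 3); first by lia.
  by have [/= -> _] := stay_step at2 erefl erefl.
(* The third bit is inspected but not erased, so [M] starts on all of [c :: z]. *)
- have [st sh] := stay_step at2 erefl erefl.
  apply: (@answer_stable _ _ (q.[size x + size (c :: z)]%R + 3)).
    apply: leq_trans t_ge; rewrite -addnA leq_add //; last by lia.
    (* The word given to [M] is two bits shorter than the padded witness at which the bound is
       evaluated. *)
    by apply: horner_nat_le => /=; lia.
  by rewrite iterD (simulation _ sh st); apply: MR.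
Qed.

Theorem theorem7 (L : language) : CeqP L -> MNS L.
Proof.
move=> [p [R [polyR LR]]]; exists (p + 2%N%:P)%R, (padded R).
split=> [|x]; first exact: polytime_padded.
have -> : nwit (p + 2%N%:P)%R (padded R) x = word_count (p.[size x]%R + 2) (padded R x).
  by rewrite /nwit -/(word_count _ _) hornerD hornerC.
rewrite LR (_ : nwit p R x = word_count p.[size x]%R (R x)) //.
case: p.[size x]%R => [|n]; rewrite addn2.
  rewrite word_count_padded0.
  (* Doubling [N = 2 ^ (-1)] would make an even natural number equal to 1. *)
  split=> [/(congr1 (fun r : rat => r * 2%:R)%R)|[t [t_gt0 ]]].
    by rewrite sub0r exprN1 mulVf // -natrM => /eqP; rewrite pnatr_eq1; lia.
  by case: t t_gt0 => // t _; rewrite expnS; have := expn_gt0 2 t; lia.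
rewrite word_count_padded -[n.+1]addn1 PoszD addrK -exprnP -natrX addn1.
have N_le := word_count_le n.+1 (R x).
have n_gt0 : 0 < 2 ^ n by rewrite expn_gt0.
split=> [/eqP|[t [_ def_t]]].
  (* The exponent comes from [2 ^ n + 3 * 2 ^ n = 2 ^ n.+2]. *)
  by rewrite eqr_nat => /eqP ->; exists n.+2; split=> //; rewrite !expnS; lia.
congr (_%:R)%R; apply: (@pow2_in_window _ _ t) => //.
(* Positivity of both minuends lets the truncated [- 1] be cancelled. *)
by have := expn_gt0 2 t; lia.
Qed.
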